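(* Let $n\geq 4$ be an integer. Then $$t(n,n-1,n-2)\leq 2n-4.$$
   Context: All graphs are finite, undirected and simple. Let $G$ be a nontrivial connected graph of order $n$ (i.e. with $n$ vertices). An edge-coloring of $G$ is any assignment of colors to the edges (adjacent edges may receive the same color). A tree $T$ that is a subgraph of $G$ is a rainbow tree if no two edges of $T$ have the same color. For $S\subseteq V(G)$ with $|S|\geq 2$, a rainbow $S$-tree is a rainbow tree $T$ in $G$ with $S\subseteq V(T)$. For an integer $k$ with $2\leq k\leq n$, an edge-coloring of $G$ is a $k$-rainbow coloring if for every $k$-subset $S$ of $V(G)$ there exists a rainbow $S$-tree. The $k$-rainbow index $rx_k(G)$ is the minimum number of colors needed in a $k$-rainbow coloring of $G$. For integers $2\leq k\leq n$ and $2\leq\ell\leq n-1$, $t(n,k,\ell)$ denotes the minimum size (number of edges) of a connected graph $G$ of order $n$ with $rx_k(G)\leq \ell$ (when such a graph exists). *)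

(* Defs.v *)
From mathcomp Require Import all_boot.

Set Implicit Arguments.
Unset Strict Implicit.
Unset Printing Implicit Defensive.

(* The vertex set is an explicit subset of the carrier [T], so that subgraphs
   of a graph over [T], with possibly fewer vertices, are again graphs over
   [T].  Edges are two-element sets of vertices. *)
Record graph (T : finType) := Graph {
  verts : {set T};
  edges : {set {set T}};
  edges_wf : forall e, e \in edges -> e \subset verts /\ #|e| = 2
}.

Definition order_of (T : finType) (G : graph T) : nat := #|verts G|.

Definition size_of (T : finType) (G : graph T) : nat := #|edges G|.

Definition adj (T : finType) (G : graph T) : rel T :=
  fun x y => [set x; y] \in edges G.

Definition subgraph (T : finType) (H G : graph T) : Prop :=
  verts H \subset verts G /\ edges H \subset edges G.

Definition connected (T : finType) (G : graph T) : Prop :=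
  verts G != set0 /\ {in verts G &, forall x y, connect (adj G) x y}.

(* [ucycle] asserts that the vertices of the cycle are distinct; the bound on
   the length excludes back-and-forth walks along a single edge. *)
Definition acyclic (T : finType) (G : graph T) : Prop :=
  forall p : seq T, ucycle (adj G) p -> size p <= 2.

Definition tree (T : finType) (G : graph T) : Prop :=
  connected G /\ acyclic G.

(* Only the values of a colouring on the edges of the graph at hand matter. *)
Definition coloring (T : finType) := {set T} -> nat.

Definition num_colors (T : finType) (G : graph T) (c : coloring T) : nat :=
  size (undup [seq c e | e <- enum (edges G)]).

Definition rainbow (T : finType) (H : graph T) (c : coloring T) : Prop :=
  {in edges H &, injective c}.

Definition rainbow_S_tree (T : finType) (G : graph T) (c : coloring T)
    (S : {set T}) (H : graph T) : Prop :=
  [/\ subgraph H G, tree H, rainbow H c & S \subset verts H].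

Definition k_rainbow_coloring (T : finType) (k : nat) (G : graph T)
    (c : coloring T) : Prop :=
  forall S : {set T}, S \subset verts G -> #|S| = k ->
    exists H : graph T, rainbow_S_tree G c S H.

Definition is_minimum (P : nat -> Prop) (m : nat) : Prop :=
  P m /\ forall j, P j -> m <= j.

(* [is_rx k G r] means rx_k(G) = r.  A relation is used rather than a function
   because a minimum need not exist for all arguments (here, for disconnected
   graphs); the same applies to [is_t]. *)
Definition is_rx (T : finType) (k : nat) (G : graph T) (r : nat) : Prop :=
  is_minimum
    (fun j => exists c : coloring T,
                k_rainbow_coloring k G c /\ num_colors G c = j) r.

(* [is_t n k l m] means t(n,k,l) = m; intended for 2 <= k <= n and
   2 <= l <= n - 1. *)
Definition is_t (n k l m : nat) : Prop :=
  is_minimum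
    (fun j => exists (T : finType) (G : graph T),
       [/\ order_of G = n, connected G,
           exists r, is_rx k G r /\ r <= l
         & size_of G = j]) m.

(* Main.v *)
Require Import Defs.
From mathcomp Require Import all_boot.
From Stdlib Require Import Classical.

Set Implicit Arguments.
Unset Strict Implicit.
Unset Printing Implicit Defensive.

(** Colour the edges of K_{2,m}, where m = n - 2, with the residues modulo m:
    with hubs v, u and spoke vertices w_i, the edge v w_i gets colour i and u w_i gets
    colour i + 1.  A rainbow tree covering all vertices but x has to be a
    spanning tree of the graph minus x that uses each of the m colours once.
    If x is a hub, the star at the other hub works.  If x = w_j, the star at v
    misses only the colour j, which is the colour of the edge u w_{j-1}, and
    this is exactly the edge needed to attach u. *)

(** [is_rx] and [is_t] are relations, so their values must be shown to exist; any witness yields a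
    minimum below it. Excluded middle is applied because [P] is an arbitrary proposition. *)
Lemma ex_is_minimum (P : nat -> Prop) (k : nat) :
  P k -> exists m, is_minimum P m /\ m <= k.
Proof.
elim/ltn_ind: k => k IHk Pk.
have [[j [lt_jk Pj]] | no_less] := classic (exists j, j < k /\ P j).
  have [m [min_m le_mj]] := IHk j lt_jk Pj.
  by exists m; split=> //; apply: leq_trans le_mj (ltnW lt_jk).
exists k; split=> //; split=> // j Pj; rewrite leqNgt.
by apply/negP => lt_jk; apply: no_less; exists j.
Qed.

Section ParentMap.

Variables (T : finType) (G : graph T).

Lemma adj_sym : symmetric (adj G).
Proof. by move=> x y; rewrite /adj setUC. Qed.

(** After rotating the cycle to start at [x], the neighbours are its second and last entries,
    distinct because there are at least three entries and none repeats. *)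
Lemma long_ucycle_neighbours (p : seq T) (x : T) :
    ucycle (adj G) p -> 2 < size p -> x \in p ->
  exists y z, [/\ y \in p, z \in p, y != z, adj G x y & adj G x z].
Proof.
move=> cyc_p size_p /rot_to[i s def_p].
have mem_p y : (y \in p) = (y \in x :: s) by rewrite -def_p mem_rot.
have: ucycle (adj G) (x :: s) by rewrite -def_p rot_ucycle.
have: 2 < size (x :: s) by rewrite -def_p size_rot.
case: s mem_p {def_p} => [|y s] //; case/lastP: s => [|s z] // mem_p _.
case/andP; rewrite /= rcons_path last_rcons => /and3P[xy _ zx].
case/and3P=> _ y_notin _; exists y, z; split=> //; last by rewrite adj_sym.
- by rewrite mem_p !inE eqxx orbT.
- by rewrite mem_p !(inE, mem_rcons) eqxx !orbT.
by apply: contraNneq y_notin => ->; rewrite mem_rcons inE eqxx.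
Qed.

Variables (r : T) (parent : T -> T) (depth : T -> nat).
Hypothesis root_vert : r \in verts G.
Hypothesis parentP : forall x, x \in verts G -> x != r ->
  [/\ parent x \in verts G, adj G x (parent x) & depth (parent x) < depth x].

Lemma connected_parent : connected G.
Proof.
split; first by apply/set0Pn; exists r.
have to_root x : x \in verts G -> connect (adj G) x r.
  have [k] := ubnP (depth x); elim: k x => // k IHk x; rewrite ltnS => lt_xk Gx.
  have [-> // | x_neq_r] := eqVneq x r.
  have [Gpx xpx lt_px] := parentP Gx x_neq_r.
  exact: connect_trans (connect1 xpx) (IHk _ (leq_trans lt_px lt_xk) Gpx).
move=> x y Gx Gy; apply: connect_trans (to_root x Gx) _.
by rewrite (sym_connect_sym adj_sym) to_root.
Qed.

(* A deepest vertex of a cycle would have two distinct parents. *)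
Lemma tree_parent :
  (forall e, e \in edges G ->
     exists x, [/\ x \in verts G, x != r & e = [set x; parent x]]) ->
  tree G.
Proof.
move=> edgeP; split; first exact: connected_parent.
move=> p cyc_p; rewrite leqNgt; apply/negP => size_p.
have [x0 x0p] : exists x, x \in p.
  by case: p size_p {cyc_p} => // x p _; exists x; rewrite mem_head.
case: (arg_maxnP depth x0p) => x xp x_max.
have [y [z [yp zp /eqP yz xy xz]]] := long_ucycle_neighbours cyc_p size_p xp.
suff up t : t \in p -> adj G x t -> t = parent x by apply: yz; rewrite (up y yp xy) (up z zp xz).
(* The edge joins [s] to its parent. If [s] is [x], then [t] is the parent of [x]; if [s] is [t],
   then [x] is the parent of [t] and so less deep, against the choice of [x]. *)
move=> tp xt; have [s [Gs s_neq_r def_e]] := edgeP _ xt.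
have [_ _ lt_ps] := parentP Gs s_neq_r.
have: s \in [set x; t] by rewrite def_e set21.
case/set2P=> def_s; subst s.
  have: t \in [set x; parent x] by rewrite -def_e set22.
  case/set2P=> // def_t; have := edges_wf xt.
  by rewrite def_t setUid cards1 => -[].
have: x \in [set t; parent t] by rewrite -def_e set21.
case/set2P=> def_x.
  by have := edges_wf xt; rewrite def_x setUid cards1 => -[].
by have := leq_trans lt_ps (x_max t tp); rewrite -def_x ltnn.
Qed.

End ParentMap.

Section CompleteBipartite.

Variable m : nat.
Hypothesis m_gt1 : 1 < m.

Local Notation V := (bool + 'I_m)%type.

(* [inl false] is the hub v, [inl true] the hub u and [inr i] is w_i. *)
Definition K2_edge (p : bool * 'I_m) : {set V} := [set inl p.1; inr p.2].

Lemma K2_edges_wf (e : {set V}) :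
  e \in [set K2_edge p | p in setT] -> e \subset [set: V] /\ #|e| = 2.
Proof. by case/imsetP=> p _ ->; rewrite subsetT cards2. Qed.

Definition K2 : graph V := Graph K2_edges_wf.

Lemma size_K2 : size_of K2 <= 2 * m.
Proof.
apply: leq_trans (leq_imset_card _ _) _.
by rewrite cardsT card_prod card_bool card_ord.
Qed.

Lemma order_K2 : order_of K2 = m.+2.
Proof. by rewrite /order_of cardsT card_sum card_bool card_ord. Qed.

(** A colouring takes an unordered edge, so the colour is a symmetric sum of vertex labels: 0 for v,
    1 for u and i for w_i, modulo m. *)
Definition K2_coloring : coloring V := fun e =>
  (\sum_(x in e) match x with inl b => nat_of_bool b | inr i => val i end) %% m.

Lemma K2_coloringE (b : bool) (i : 'I_m) :
  K2_coloring [set inl b; inr i] = (b + i) %% m.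
Proof. by rewrite /K2_coloring big_setU1 ?big_set1 // inE. Qed.

Lemma num_colors_K2 : num_colors K2 K2_coloring <= m.
Proof.
rewrite -[leqRHS](size_iota 0); apply: uniq_leq_size (undup_uniq _) _ => c.
rewrite mem_undup => /mapP[e _ ->]; rewrite mem_iota /= ltn_pmod //.
exact: ltnW.
Qed.

(* Root, parent map and depth function of the rainbow tree that avoids [x]. *)
Definition K2_root (x : V) : V :=
  match x with inl b => inl (~~ b) | inr _ => inl false end.

Definition K2_parent (x y : V) : V :=
  match x, y with
  | inr j, inl _ => inr (ord_pred j)
  | _, _ => K2_root x
  end.

Definition K2_depth (x y : V) : nat :=
  if y == K2_root x then 0 else if y is inr _ then 1 else 2.

Definition K2_tree_edges (x : V) : {set {set V}} :=
  [set [set y; K2_parent x y] | y in ~: [set x; K2_root x]].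

(** A cyclic shift modulo m > 1 has no fixed point; hence the vertex to which u is attached is not
    the omitted w_j. *)
Lemma ord_pred_neq (j : 'I_m) : ord_pred j != j.
Proof.
rewrite -{2}(ord_predK j) -val_eqE /=; set i := (_ %% m).
have: i < m by rewrite ltn_pmod // ltnW.
rewrite leq_eqVlt => /predU1P[Si_m | lt_Si_m]; last first.
  by rewrite modn_small // neq_ltn leqnn.
by rewrite Si_m modnn -lt0n -ltnS Si_m.
Qed.

Lemma K2_parentP (x y : V) : y != x -> y != K2_root x ->
  [/\ K2_parent x y != x, adj K2 y (K2_parent x y)
    & K2_depth x (K2_parent x y) < K2_depth x y].
Proof.
have edge b i : [set inl b; inr i] \in edges K2.
  by apply/imsetP; exists (b, i).
case: x y => [b | j] [b' | i]; rewrite /K2_depth /adj /=.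
- by case: b b' => [] [].
- by rewrite setUC eqxx => _ _; split; [case: b | apply: edge |].
- by case: b' => // _ _; split; [apply: ord_pred_neq | apply: edge |].
- by rewrite setUC => _ _; split=> //; apply: edge.
Qed.

Lemma K2_tree_edges_wf (x : V) (e : {set V}) :
  e \in K2_tree_edges x -> e \subset ~: [set x] /\ #|e| = 2.
Proof.
case/imsetP=> y; rewrite in_setC in_set2 negb_or => /andP[yx yr] ->.
have [px /edges_wf[_ card_e] _] := K2_parentP yx yr.
split=> //; apply/subsetP => z; rewrite in_setC in_set1.
by case/set2P=> ->.
Qed.

Definition K2_tree (x : V) : graph V := Graph (@K2_tree_edges_wf x).

Lemma K2_tree_subgraph (x : V) : subgraph (K2_tree x) K2.
Proof.
split; first exact: subsetT.
apply/subsetP => _ /imsetP[y + ->].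
by rewrite in_setC in_set2 negb_or => /andP[yx yr]; case: (K2_parentP yx yr).
Qed.

Lemma K2_root_neq (x : V) : K2_root x != x.
Proof. by case: x => [[]|]. Qed.

Lemma K2_tree_parentP (x y : V) : y \in verts (K2_tree x) -> y != K2_root x ->
  [/\ K2_parent x y \in verts (K2_tree x), adj (K2_tree x) y (K2_parent x y)
    & K2_depth x (K2_parent x y) < K2_depth x y].
Proof.
rewrite !in_setC1 => yx yr; have [px _ lt_d] := K2_parentP yx yr.
by split=> //; apply/imsetP; exists y; rewrite // in_setC in_set2 negb_or yx.
Qed.

Lemma K2_tree_tree (x : V) : tree (K2_tree x).
Proof.
apply: (tree_parent _ (@K2_tree_parentP x)).
  by rewrite in_setC1 K2_root_neq.
move=> _ /imsetP[y + ->]; rewrite in_setC in_set2 negb_or => /andP[yx yr].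
by exists y; rewrite in_setC1.
Qed.

Lemma K2_tree_rainbow (x : V) : rainbow (K2_tree x) K2_coloring.
Proof.
move=> _ _ /imsetP[y + ->] /imsetP[z + ->].
rewrite !in_setC !in_set2 !negb_or => /andP[yx yr] /andP[zx zr] eq_col.
(* Each tree edge is named by its child end, so it suffices that the colour determines the child. *)
suff -> : y = z by [].
have pendant (j : 'I_m) :
    K2_coloring [set inl true; inr (ord_pred j)] = j.
  by rewrite K2_coloringE -[in RHS](ord_predK j).
have spoke (i : 'I_m) : K2_coloring [set inr i; inl false] = i.
  by rewrite setUC K2_coloringE modn_small //; apply: ltn_ord.
case: x y z yx yr zx zr eq_col => [b | j] [b1 | i1] [b2 | i2] /=.
(* When a hub is omitted and the other is the root, no child is a hub. *)
1-3: by case: b => //; do ?[case: b1 => //]; do ?[case: b2 => //].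
- move=> _ _ _ _; rewrite ![[set inr _; _]]setUC !K2_coloringE => /eqP.
  by rewrite eqn_modDl !modn_small // val_eqE => /eqP->.
- by case: b1 b2 => [] [].
(* The edge at u has colour j, and a spoke of that colour would end at the omitted w_j. *)
- case: b1 => // _ _ i2j _; rewrite pendant spoke => /val_inj j_i2.
  by rewrite j_i2 eqxx in i2j.
- case: b2 => // i1j _ _ _; rewrite pendant spoke => /val_inj i1_j.
  by rewrite i1_j eqxx in i1j.
- by move=> _ _ _ _; rewrite !spoke => /val_inj->.
Qed.

Lemma K2_connected : connected K2.
Proof.
pose j : 'I_m := Ordinal (ltnW m_gt1).
have edge b i : [set inl b; inr i] \in edges K2.
  by apply/imsetP; exists (b, i).
(* The parent map of the tree avoiding w_j also sends w_j itself to v, so it reaches every vertex of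
   [K2]. *)
apply: (@connected_parent _ _ (inl false) (K2_parent (inr j)) (K2_depth (inr j))).
  exact: in_setT.
by move=> [[]|i] //= _ _; split; rewrite ?in_setT /adj //= setUC.
Qed.

Lemma K2_rainbow : k_rainbow_coloring m.+1 K2 K2_coloring.
Proof.
(* A set of m + 1 of the m + 2 vertices misses exactly one, and the tree is the one avoiding it. *)
move=> S _ card_S; have /cards1P[x def_x] : #|~: S| == 1.
  have := cardsC S; rewrite card_S card_sum card_bool card_ord.
  by rewrite -addn1 -addnA addnC => /eqP; rewrite eqn_add2r.
exists (K2_tree x); split.
- exact: K2_tree_subgraph.
- exact: K2_tree_tree.
- exact: K2_tree_rainbow.
by rewrite /= -def_x setCK.
Qed.

End CompleteBipartite.

Theorem theorem2p15 (n : nat) (hn : 4 <= n) :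
  exists m : nat, is_t n (n - 1) (n - 2) m /\ m <= 2 * n - 4.
Proof.
have [m m_gt1 ->] : exists2 m, 1 < m & n = m.+2.
  by case: n hn => [|[|m]] //; exists m.
have -> : 2 * m.+2 - 4 = 2 * m by rewrite -[m.+2]addn2 mulnDr addnK.
rewrite subn1 subn2 /=.
(* The explicit colouring bounds the rainbow index of [K2] by m; this makes [K2] a competitor in the
   minimum defining t. *)
have [r [min_r le_r]] : exists r, is_rx m.+1 (K2 m) r /\ r <= m.
  have [|r [min_r le_r]] := @ex_is_minimum (fun j => exists c : coloring _,
    k_rainbow_coloring m.+1 (K2 m) c /\ num_colors (K2 m) c = j)
    (num_colors (K2 m) (@K2_coloring m)).
    by exists (@K2_coloring m); split=> //; apply: K2_rainbow.
  by exists r; split=> //; apply: leq_trans le_r (num_colors_K2 m_gt1).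
have [|t [min_t le_t]] := @ex_is_minimum (fun j =>
  exists (T : finType) (G : graph T),
    [/\ order_of G = m.+2, connected G, exists r, is_rx m.+1 G r /\ r <= m
      & size_of G = j]) (size_of (K2 m)).
  exists (bool + 'I_m)%type, (K2 m); split=> //.
  - exact: order_K2.
  - exact: K2_connected.
  - by exists r.
by exists t; split=> //; apply: leq_trans le_t (size_K2 m).
Qed.
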